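(* Consider the fractional order system $${}_0^C\mathrm{D}_t^\alpha X=f(X),\qquad 0<\alpha<1,$$ where $f\in C^1(E)$ and $E$ is an open set in $\mathbb{R}^n$. Suppose $X_*=0$ is an equilibrium of the system. Let $\Phi_t(X_0)$ be the solution of the system with initial condition $X(0)=X_0$. Then any curve $g(x,y)=c$ which is not a straight line (i.e. has curvature $>0$) cannot be invariant under $\Phi_t$.
   Context: ${}_0^C\mathrm{D}_t^\alpha$ denotes the Caputo fractional derivative: for $0<\alpha<1$, ${}_0^{C}\mathrm{D}_t^\alpha x(t)=\frac{1}{\Gamma(1-\alpha)}\int_0^t (t-\tau)^{-\alpha}x'(\tau)\,d\tau$ (componentwise). A point $X_*$ is an equilibrium if $f(X_* )=0$. The curve $g(x,y)=c$ is a curve in the phase space given by an equation in the coordinates $(x,y)$ of $X$. A set $S$ is invariant under $\Phi_t$ if any solution starting on $S$ stays on $S$ for all time, i.e. $\Phi_t(X_0)\in S$ for all $X_0\in S$ and all $t\ge 0$ for which the solution exists.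
   Formalization: The claim fails for curves made of equilibria (e.g. f=0, unit circle), so the theorem assumes some point of the curve has curvature >0 and is not an equilibrium; g is C^2, and coordinates other than x,y are constant on the curve. *)

(* Defs.v *)
From mathcomp Require Import all_boot all_order all_algebra.
From mathcomp Require Import all_classical all_reals all_analysis.

Set Implicit Arguments.
Unset Strict Implicit.
Unset Printing Implicit Defensive.

Import Order.TTheory GRing.Theory Num.Theory.
Import numFieldNormedType.Exports.

Local Open Scope classical_set_scope.
Local Open Scope ring_scope.

(* Between finite-dimensional spaces this is the usual class C^1: joint
   continuity of [x, v |-> 'D_v f x] follows from continuity in [x] for each
   [v], since ['D_v f x] is linear in [v]. *)
Definition C1_on (R : realType) (V W : normedModType R)
    (f : V -> W) (D : set V) : Prop :=
  forall x, D x ->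
    differentiable f x /\ forall v : V, {for x, continuous ('D_v f)}.

Definition C2_on (R : realType) (V W : normedModType R)
    (f : V -> W) (D : set V) : Prop :=
  C1_on f D /\ forall v : V, C1_on ('D_v f) D.

Definition Gamma (R : realType) (z : R) : R :=
  \int[lebesgue_measure]_(t in `]0, +oo[) (t `^ (z - 1) * expR (- t)).

Definition caputo_integrand (R : realType) (alpha : R) (x : R -> R)
    (t tau : R) : R :=
  (t - tau) `^ (- alpha) * derive1 x tau.

(* Meaningful for [0 < alpha < 1] and [0 < t] when the integrand is
   integrable, which [caputo_solution] requires explicitly. *)
Definition caputo (R : realType) (alpha : R) (x : R -> R) (t : R) : R :=
  (Gamma (1 - alpha))^-1 *
  \int[lebesgue_measure]_(tau in `]0, t[) caputo_integrand alpha x t tau.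

(* [X] solves the system on [0, T[, with [T] possibly infinite. Solutions lie
   in C[0, T[ and C^1]0, T[, which is the regularity available when [f] is C^1:
   [X'] generally blows up like [t ^ (alpha - 1)] at [0]. For the same reason
   the equation is imposed for [t > 0] only (at [t = 0] the Caputo integral is
   void, whereas [f (X 0)] need not vanish). *)
Definition caputo_solution (R : realType) (n : nat) (alpha : R)
    (f : 'rV[R]_n -> 'rV[R]_n) (E : set 'rV[R]_n)
    (X : R -> 'rV[R]_n) (T : \bar R) : Prop :=
  [/\ {within [set t : R | 0 <= t /\ (t%:E < T)%E], continuous X},
      forall t : R, 0 <= t -> (t%:E < T)%E -> E (X t) &
      forall (t : R) (k : 'I_n), 0 < t -> (t%:E < T)%E ->
        let x := fun s : R => X s ord0 k in
        [/\ derivable x t 1,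
            {for t, continuous (derive1 x)},
            lebesgue_measure.-integrable `]0, t[
              (fun tau => (caputo_integrand alpha x t tau)%:E) &
            caputo alpha x t = f (X t) ord0 k]].

(* [Phi t X0] is the solution starting at [X0], which exists for
   [0 <= t < T X0]; the values of [Phi] at other times are irrelevant. *)
Definition solution_map (R : realType) (n : nat) (alpha : R)
    (f : 'rV[R]_n -> 'rV[R]_n) (E : set 'rV[R]_n)
    (Phi : R -> 'rV[R]_n -> 'rV[R]_n) (T : 'rV[R]_n -> \bar R) : Prop :=
  forall X0, E X0 ->
    [/\ (0%E < T X0)%E, Phi 0 X0 = X0 &
        caputo_solution alpha f E (Phi ^~ X0) (T X0)].

Definition invariant_under (R : realType) (n : nat)
    (Phi : R -> 'rV[R]_n -> 'rV[R]_n) (T : 'rV[R]_n -> \bar R)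
    (S : set 'rV[R]_n) : Prop :=
  forall X0, S X0 -> forall t : R, 0 <= t -> (t%:E < T X0)%E -> S (Phi t X0).

Definition equilibrium (R : realType) (n : nat)
    (f : 'rV[R]_n -> 'rV[R]_n) (E : set 'rV[R]_n) (X : 'rV[R]_n) : Prop :=
  E X /\ f X = 0.

Definition coord_pair (R : realType) (n : nat) (i j : 'I_n) (X : 'rV[R]_n) :
    R * R :=
  (X ord0 i, X ord0 j).

(* The curve [g(x, y) = c] in the phase space, where [x] and [y] are the [i]-th
   and [j]-th coordinates, [g] has domain [D], and any remaining coordinate is
   constant, equal to that of [P] (there is none when [n = 2]). *)
Definition level_curve (R : realType) (n : nat) (E : set 'rV[R]_n)
    (i j : 'I_n) (P : 'rV[R]_n) (D : set (R * R)) (g : R * R -> R) (c : R) :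
    set 'rV[R]_n :=
  [set X | [/\ E X, D (coord_pair i j X), g (coord_pair i j X) = c &
               forall k : 'I_n, k != i -> k != j -> X ord0 k = P ord0 k]].

(* Curvature at [p] of the level curve of [g] through [p]:
     |g_xx g_y^2 - 2 g_xy g_x g_y + g_yy g_x^2| / (g_x^2 + g_y^2)^(3/2).
   As [a / 0 = 0], a positive value entails a nonzero gradient at [p]. *)
Definition curvature (R : realType) (g : R * R -> R) (p : R * R) : R :=
  let ex : R * R := (1, 0) in
  let ey : R * R := (0, 1) in
  let gx := 'D_ex g p in
  let gy := 'D_ey g p in
  let gxx := 'D_ex ('D_ex g) p in
  let gxy := 'D_ey ('D_ex g) p in
  let gyy := 'D_ey ('D_ey g) p in
  `|gxx * gy ^+ 2 - 2 * gxy * gx * gy + gyy * gx ^+ 2|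
    / Num.sqrt (gx ^+ 2 + gy ^+ 2) ^+ 3.

(* Main.v *)
Require Import Defs.
From mathcomp Require Import all_boot all_order all_algebra.
From mathcomp Require Import all_classical all_reals all_analysis.
From mathcomp Require Import measurable_realfun.
From mathcomp Require Import ring lra.
Import Order.TTheory GRing.Theory Num.Theory.
Import numFieldNormedType.Exports.
Local Open Scope classical_set_scope.
Local Open Scope ring_scope.

(* Near a point of positive curvature, the level curve lies strictly on one side
   of each of its tangents. So, for a solution X staying on the curve and a
   normal w to the curve at Y = X(t), suitably oriented, the function w . X has
   on [0, t] a maximum at t, and integrating by parts against the kernel
   (t - tau)^(-alpha) shows that its Caputo derivative w . f(Y) at t is positive
   unless X(t) = X(0). On the other hand, the solution starting at Y also stays
   on the curve, so that w . X is maximal at time 0; hence w . f(Y) <= 0, a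
   function with positive Caputo derivative near 0 being somewhere larger than
   its initial value. Thus X is constant near time 0, i.e. X(0) is an
   equilibrium. *)

(** * Integration by parts against the singular kernel *)

Lemma integrable_itv_oo_cc {R : realType} {a b : R} {h : R -> R} :
  lebesgue_measure.-integrable `]a, b[ (EFin \o h) ->
  lebesgue_measure.-integrable `[a, b] (EFin \o h).
Proof.
move=> /integrableP[mh ih]; apply/integrableP.
have mhco := (emeasurable_fun_itv_obnd_cbndP a (BLeft b) (EFin \o h)).1 mh.
split; first exact/emeasurable_fun_itv_bndo_bndcP.
rewrite -integral_itv_bndo_bndc; last exact: measurableT_comp.
by rewrite -integral_itv_obnd_cbnd//; exact: measurableT_comp.
Qed.

(** The product is [(t - tau)] to the power [1 - alpha], which tends to 0, times a difference
    quotient of [psi], which tends to the derivative at [t]. *)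
Lemma powR_diff_quotient_cvg0 {R : realType} (alpha t : R) (psi : R -> R) :
  alpha < 1 -> derivable psi t 1 ->
  (t - tau) `^ (- alpha) * (psi t - psi tau) @[tau --> t^'-] --> (0 : R).
Proof.
move=> a1 dpsi.
have c1 : (tau - t) @[tau --> t^'-] --> (0 : R)^'.
  move=> A /= [e /= e0 H]; exists e => //= x xe xt; apply: H => /=.
    by rewrite sub0r normrN -normrN opprB.
  by rewrite subr_eq0 lt_eqF.
have c2 : (t - tau) @[tau --> t^'-] --> (0 : R)^'+.
  move=> A /= [e /= e0 H]; exists e => //= x xe xt; apply: H => /=.
    by rewrite sub0r normrN.
  by rewrite subr_gt0.
have /= d1 := cvg_comp _ _ c1 dpsi.
have e1 : 0 < 1 - alpha by rewrite subr_gt0.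
have /= d2 := cvg_comp _ _ c2 (powR_cvg0 e1).
have d3 : (t - tau) `^ (1 - alpha) * ((tau - t)^-1 * (psi tau - psi t))
    @[tau --> t^'-] --> (0 : R).
  have := cvgM d2 d1 => /(_ _); rewrite mul0r => /(_ _).
  suff -> : (fun h : R => h^-1 *: (psi (h%:A + t) - psi t)) \o +%R^~ (- t) =
      (fun tau => (tau - t)^-1 * (psi tau - psi t)) by exact.
  by apply/funext => tau /=; rewrite /GRing.scale/= mulr1 subrK.
apply: cvg_trans d3; apply: near_eq_cvg; near=> tau.
have tt : 0 < t - tau by rewrite subr_gt0; near: tau; exact: nbhs_left_lt.
rewrite /= powRD ?powRr1 ?ltW//; last first.
  by apply/implyP => _; rewrite gt_eqF.
have -> : tau - t = - (t - tau) by rewrite opprB.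
by field; rewrite gt_eqF.
Unshelve. all: by end_near. Qed.

(** Integration by parts in the form of monotonicity: the primitive [F] of the integrand plus the
    boundary term [K] is nondecreasing on [0, t], and the bound is [K 0]. The remaining integral,
    singular at [t], is thus never formed. *)
Lemma caputo_integral_ge {R : realType} (alpha t : R) (psi : R -> R) :
  0 < alpha -> alpha < 1 -> 0 < t ->
  {within `[0, t], continuous psi} ->
  (forall s : R, s \in `]0, t] -> derivable psi s 1) ->
  (forall s : R, s \in `]0, t[ -> {for s, continuous (derive1 psi)}) ->
  lebesgue_measure.-integrable `]0, t[
    (EFin \o caputo_integrand alpha psi t) ->
  (forall s : R, s \in `[0, t] -> psi s <= psi t) ->
  t `^ (- alpha) * (psi t - psi 0) <=
    \int[lebesgue_measure]_(s in `]0, t[) caputo_integrand alpha psi t s.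
Proof.
move=> a0 a1 t0 cpsi dpsi ddpsi ipsi maxpsi.
set h := caputo_integrand alpha psi t.
pose F x := \int[lebesgue_measure]_(s in `[0, x]) h s.
pose K s := (t - s) `^ (- alpha) * (psi t - psi s).
have ih := integrable_itv_oo_cc ipsi.
have cF : {within `[0, t], continuous F}.
  exact: (parameterized_integral_continuous (ltW t0) ih).
have dpow s : s < t -> is_derive s 1 (fun s => (t - s) `^ (- alpha))
   (alpha * (t - s) `^ (- alpha - 1)).
  move=> st; have ts : 0 < t - s by rewrite subr_gt0.
  have H : is_derive s 1 (fun s : R => t - s) (-1).
    have := is_deriveB (is_derive_cst t s 1) (is_derive_id s (1 : R)).
    by rewrite sub0r.
  have Hp := is_derive1_powR (- alpha) ts.
  have := @is_derive1_comp _ _ _ s _ _ Hp H.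
  by rewrite /comp mulrN1 mulNr opprK.
have cpow s : s < t -> {for s, continuous (fun s => (t - s) `^ (- alpha))}.
  move=> st; apply/differentiable_continuous/derivable1_diffP.
  by have [] := dpow _ st.
have dK s : s \in `]0, t[ -> is_derive s 1 K
    (alpha * (t - s) `^ (- alpha - 1) * (psi t - psi s) - h s).
  rewrite in_itv/= => /andP[s0 st].
  have dps : is_derive s 1 psi (derive1 psi s).
    by rewrite derive1E; apply/derivableP/dpsi; rewrite in_itv/= s0 ltW.
  have := dpow _ st => dp.
  have dd : is_derive s 1 (fun s => psi t - psi s) (- derive1 psi s).
    by have := is_deriveB (is_derive_cst (psi t) s 1) dps; rewrite sub0r.
  have := is_deriveM dp dd; rewrite /K => H.
  apply: is_derive_eq; rewrite /h /caputo_integrand /GRing.scale/=; ring.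
have cK : {within `[0, t], continuous K}.
  apply/(continuous_within_itvP _ t0); split.
  - move=> s /dK dKs; apply/differentiable_continuous/derivable1_diffP.
    exact: ex_derive.
  - apply: cvgM.
      by apply: cvg_at_right_filter; exact: cpow t0.
    apply: cvgB; first exact: cvg_cst.
    by have /(continuous_within_itvP _ t0)[] := cpsi.
  (* At [t] the kernel is a negative power of 0, a default value; it is harmless because the other
     factor of [K t] is 0. *)
  - rewrite {2}/K [psi t - psi t]subrr mulr0.
    apply: powR_diff_quotient_cvg0 => //.
    by apply: dpsi; rewrite in_itv/= t0 lexx.
have dF s : s \in `]0, t[ -> is_derive s 1 F (h s).
  rewrite in_itv/= => /andP[s0 st].
  have ch : {for s, continuous h}.
    apply: continuousM; last by apply: ddpsi; rewrite in_itv/= s0.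
    exact: cpow.
  have [dFs FE] := continuous_FTC1_closed st ih s0 ch.
  by apply: (is_derive_eq (derivableP dFs)); rewrite -[RHS]FE derive1E.
(* [K] is the boundary term of the integration by parts and extends continuously
   to [t]; the remaining integrand is nonnegative since [psi] is maximal at
   [t]. *)
have dFK s : s \in `]0, t[ -> is_derive s 1 (F + K)
    (alpha * (t - s) `^ (- alpha - 1) * (psi t - psi s)).
  move=> st; have h1 := dF _ st; have h2 := dK _ st.
  apply: is_derive_eq; ring.
have cFK : {within `[0, t], continuous (F + K)}.
  by move=> s; apply: continuousD; [exact: cF|exact: cK].
have mono : (F + K) 0 <= (F + K) t.
  apply: (ger0_derive1_le_cc _ _ cFK); rewrite ?in_itv/= ?lexx ?ltW//.
    by move=> s /dFK [].
  move=> s st; rewrite derive1E; rewrite (@derive_val _ _ _ _ _ _ _ (dFK _ st)).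
  move: st; rewrite in_itv/= => /andP[s0 st].
  apply: mulr_ge0; first exact: mulr_ge0 (ltW a0) (powR_ge0 _ _).
  by rewrite subr_ge0; apply: maxpsi; rewrite in_itv/= !ltW.
have {mono} : F 0 + K 0 <= F t + K t by [].
(* [F 0] is an integral over a single point and [K t] vanishes, so only [K 0 <= F t] is left. *)
rewrite {1}/F set_itv1 Rintegral_set1 add0r /K subr0 [psi t - psi t]subrr.
rewrite mulr0 addr0 => /le_trans; apply; rewrite le_eqVlt; apply/predU1P; left.
rewrite /F; symmetry; rewrite -/h.
rewrite -Rintegral_itv_bndo_bndc.
  by rewrite -Rintegral_itv_obnd_cbnd.
apply: integrableS ih => //.
by apply: subset_itv; rewrite bnd_simp.
Qed.

(** * Linearity of the Caputo derivative *)

(** The regularity of one component of a solution, detached from the equation so that it passes to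
    linear combinations of components, such as the scalar product with a normal. *)
Definition caputo_regular {R : realType} (alpha : R) (x : R -> R)
    (T : \bar R) : Prop :=
  {within [set t : R | 0 <= t /\ (t%:E < T)%E], continuous x} /\
  forall t : R, 0 < t -> (t%:E < T)%E ->
    [/\ derivable x t 1, {for t, continuous (derive1 x)} &
        lebesgue_measure.-integrable `]0, t[
          (EFin \o caputo_integrand alpha x t)].

Lemma derive1_lincomb {R : realType} (a b : R) {t : R} {x y : R -> R} :
  derivable x t 1 -> derivable y t 1 ->
  is_derive t 1 (fun s => a * x s + b * y s)
    (a * derive1 x t + b * derive1 y t).
Proof.
move=> dx dy; rewrite !derive1E.
exact: (is_deriveD (is_deriveZ a (derivableP dx))
                   (is_deriveZ b (derivableP dy))).
Qed.

Lemma caputo_integrand_lincomb {R : realType} (alpha a b t s : R)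
    (x y : R -> R) :
  derivable x s 1 -> derivable y s 1 ->
  caputo_integrand alpha (fun u => a * x u + b * y u) t s =
  a * caputo_integrand alpha x t s + b * caputo_integrand alpha y t s.
Proof.
move=> dx dy; rewrite /caputo_integrand derive1E.
rewrite (@derive_val _ _ _ _ _ _ _ (derive1_lincomb a b dx dy)); ring.
Qed.

Section lincomb.
Context {R : realType} {alpha : R} {T : \bar R} {x y : R -> R}.
Hypotheses (rx : caputo_regular alpha x T) (ry : caputo_regular alpha y T).
Variables a b : R.

Lemma caputo_regular_lincomb :
  caputo_regular alpha (fun s => a * x s + b * y s) T.
Proof.
have [cx dx] := rx; have [cy dy] := ry; split.
  by move=> s; apply: cvgD; apply: cvgM;
    [exact: cvg_cst|exact: cx|exact: cvg_cst|exact: cy].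
move=> t t0 tT; have [dxt cdx ix] := dx t t0 tT.
have [dyt cdy iy] := dy t t0 tT; split.
- by have [] := derive1_lincomb a b dxt dyt.
(* Continuity of [derive1] at [t] involves the derivative at nearby times, and its formula is
   available only strictly between 0 and [T]. *)
- have nT : \forall s \near t, (s%:E < T)%E.
    case: (T) tT => [r tr| _|//]; near=> s; rewrite ?ltry// lte_fin.
    by near: s; exact: lt_nbhsl.
  have C : a * derive1 x s + b * derive1 y s @[s --> t] -->
      a * derive1 x t + b * derive1 y t.
    by apply: cvgD; apply: cvgM => //; exact: cvg_cst.
  have D : derive1 (fun s => a * x s + b * y s) t =
      a * derive1 x t + b * derive1 y t.
    rewrite derive1E.
    by rewrite (@derive_val _ _ _ _ _ _ _ (derive1_lincomb a b dxt dyt)).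
  rewrite -D in C; apply: cvg_trans C; apply: near_eq_cvg; near=> s.
  have s0 : 0 < s by near: s; exact: lt_nbhsr.
  have sT : (s%:E < T)%E by near: s.
  have [dxs _ _] := dx s s0 sT; have [dys _ _] := dy s s0 sT.
  rewrite [RHS]derive1E.
  by rewrite (@derive_val _ _ _ _ _ _ _ (derive1_lincomb a b dxs dys)).
- have ax := fun mI => integrableZl mI a ix.
  have iby := fun mI => integrableZl mI b iy.
  have H := fun mI => integrableD mI (ax mI) (iby mI).
  apply: eq_integrable (H _) => //.
  move=> s; rewrite inE/= in_itv/= => /andP[s0 st].
  have sT : (s%:E < T)%E by apply: lt_trans tT; rewrite lte_fin.
  rewrite caputo_integrand_lincomb ?EFinD//.
    by have [] := dx s s0 sT.
  by have [] := dy s s0 sT.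
Unshelve. all: by end_near. Qed.

Lemma caputo_lincomb t : 0 < t -> (t%:E < T)%E ->
  caputo alpha (fun s => a * x s + b * y s) t =
  a * caputo alpha x t + b * caputo alpha y t.
Proof.
move=> t0 tT; have [_ dx] := rx; have [_ dy] := ry.
have [_ _ ix] := dx t t0 tT; have [_ _ iy] := dy t t0 tT.
rewrite /caputo.
have -> : \int[lebesgue_measure]_(s in `]0, t[)
    caputo_integrand alpha (fun s => a * x s + b * y s) t s =
  \int[lebesgue_measure]_(s in `]0, t[)
    (a * caputo_integrand alpha x t s + b * caputo_integrand alpha y t s).
  apply: eq_Rintegral => s; rewrite inE/= in_itv/= => /andP[s0 st].
  have sT : (s%:E < T)%E by apply: lt_trans tT; rewrite lte_fin.
  rewrite caputo_integrand_lincomb//.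
    by have [] := dx s s0 sT.
  by have [] := dy s s0 sT.
rewrite RintegralD//; last 2 first.
- exact: (integrableZl _ _ ix).
- exact: (integrableZl _ _ iy).
rewrite !RintegralZl//; ring.
Qed.

End lincomb.

(** * Extremum principles for the Caputo derivative *)

Lemma Gamma_ge0 {R : realType} (z : R) : 0 <= Gamma z.
Proof.
by apply: Rintegral_ge0 => t _; rewrite mulr_ge0 ?powR_ge0 ?expR_ge0.
Qed.

Lemma itv_cc_subset {R : realType} {T : \bar R} {t : R} : (t%:E < T)%E ->
  `[0, t] `<=` [set s : R | 0 <= s /\ (s%:E < T)%E].
Proof.
move=> tT s /=; rewrite in_itv/= => /andP[s0 st]; split => //.
by apply: le_lt_trans tT; rewrite lee_fin.
Qed.

(** The Caputo derivative sees the whole past, so at a maximum over [0, t] it dominates a multiple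
    of the total increase [psi t - psi 0]. Keeping this term is what later allows a strict
    inequality. *)
Lemma caputo_ge_at_max {R : realType} {alpha t : R} {T : \bar R}
    {psi : R -> R} :
  0 < alpha -> alpha < 1 -> caputo_regular alpha psi T ->
  0 < t -> (t%:E < T)%E ->
  (forall s : R, s \in `[0, t] -> psi s <= psi t) ->
  (Gamma (1 - alpha))^-1 * (t `^ (- alpha) * (psi t - psi 0)) <=
    caputo alpha psi t.
Proof.
move=> a0 a1 [cpsi dpsi] t0 tT maxpsi.
apply: ler_wpM2l; first by rewrite invr_ge0 Gamma_ge0.
have [_ _ ipsi] := dpsi t t0 tT.
apply: caputo_integral_ge => //.
- exact: continuous_subspaceW (itv_cc_subset tT) cpsi.
- move=> s; rewrite in_itv/= => /andP[s0 st].
  have sT : (s%:E < T)%E by apply: le_lt_trans tT; rewrite lee_fin.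
  by have [] := dpsi s s0 sT.
- move=> s; rewrite in_itv/= => /andP[s0 st].
  have sT : (s%:E < T)%E by apply: lt_trans tT; rewrite lte_fin.
  by have [] := dpsi s s0 sT.
Qed.

(** Otherwise [psi 0] is the maximum on [0, d]. A minimum at a positive time contradicts the
    extremum principle for [- psi]; a minimum at 0 makes [psi] constant, so that [d] is a minimum at
    a positive time as well. *)
Lemma caputo_gt0_increase {R : realType} {alpha d : R} {T : \bar R}
    {psi : R -> R} :
  0 < alpha -> alpha < 1 -> caputo_regular alpha psi T ->
  0 < d -> (d%:E < T)%E ->
  (forall s : R, s \in `]0, d] -> 0 < caputo alpha psi s) ->
  exists2 s, s \in `]0, d] & psi 0 < psi s.
Proof.
move=> a0 a1 rpsi d0 dT pos; apply: contrapT => noinc.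
have le0 s : s \in `[0, d] -> psi s <= psi 0.
  rewrite in_itv/= le_eqVlt => /andP[/predU1P[<-//|s0] sd].
  rewrite leNgt; apply/negP => lt0s; apply: noinc; exists s => //.
  by rewrite in_itv/= s0.
have cpsi : {within `[0, d], continuous psi}.
  by apply: continuous_subspaceW (itv_cc_subset dT) _; case: rpsi.
have not_min c : c \in `]0, d] ->
    ~ (forall s : R, s \in `[0, d] -> psi c <= psi s).
  move=> cd minc; move: (cd); rewrite in_itv/= => /andP[c0 cled].
  have cT : (c%:E < T)%E by apply: le_lt_trans dT; rewrite lee_fin.
  (* [- psi] is taken as the combination with coefficients -1 and 0, to which linearity applies. *)
  have /= := caputo_ge_at_max a0 a1 (caputo_regular_lincomb rpsi rpsi (-1) 0)
    c0 cT.
  rewrite (caputo_lincomb rpsi rpsi)// !mul0r !addr0 !mulN1r => H.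
  have /H : forall s : R, s \in `[0, c] ->
      -1 * psi s + 0 * psi s <= - psi c.
    move=> s; rewrite in_itv/= => /andP[s0 sc].
    rewrite mul0r addr0 mulN1r lerN2 minc// in_itv/= s0.
    exact: le_trans cled.
  apply/negP; rewrite -ltNge; apply: (@lt_le_trans _ _ 0).
    by rewrite oppr_lt0 pos.
  rewrite mulr_ge0 ?invr_ge0 ?Gamma_ge0// mulr_ge0 ?powR_ge0//.
  by rewrite opprK addrC subr_ge0 minc// in_itv/= lexx ltW.
have [c + minc] := EVT_min (ltW d0) cpsi.
rewrite in_itv/= le_eqVlt => /andP[/predU1P[c0|c0] cd]; last first.
  by apply: (not_min c); rewrite // in_itv/= c0.
apply: (not_min d); first by rewrite in_itv/= d0 lexx.
move=> s sd; apply: le_trans (minc s sd); rewrite -c0.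
by apply: le0; rewrite in_itv/= ltW//= lexx.
Qed.

(** * Mean values along lines and symmetry of second derivatives *)

Lemma is_derive_line {R : realType} {V W : normedModType R} (G : V -> W)
    (q v : V) (s : R) : derivable G (q + s *: v) v ->
  is_derive s 1 (fun s => G (q + s *: v)) ('D_v G (q + s *: v)).
Proof.
move=> dG.
have E : (fun h => h^-1 *: (G (q + (h *: 1 + s) *: v) - G (q + s *: v))) =
         (fun h => h^-1 *: (G (h *: v + (q + s *: v)) - G (q + s *: v))).
  apply/funext => h; congr (_ *: (G _ - _)).
  by rewrite scalerDl addrCA /GRing.scale/= mulr1.
apply: DeriveDef; first by rewrite /derivable E.
by rewrite /derive E.
Qed.

Lemma MVT_line {R : realType} {V : normedModType R} (G : V -> R) (q v : V)
    (h : R) : 0 < h ->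
  (forall s : R, s \in `[0, h] -> derivable G (q + s *: v) v) ->
  exists2 s, s \in `]0, h[ &
    G (q + h *: v) - G q = 'D_v G (q + s *: v) * h.
Proof.
move=> h0 dG.
have dl s : s \in `[0, h] ->
    is_derive s 1 (fun s => G (q + s *: v)) ('D_v G (q + s *: v)).
  by move=> /dG; exact: is_derive_line.
have dlo s : s \in `]0, h[ ->
    is_derive s 1 (fun s => G (q + s *: v)) ('D_v G (q + s *: v)).
  by move=> sh; apply: dl; apply: subset_itv_oo_cc sh.
have cl : {within `[0, h], continuous (fun s => G (q + s *: v))}.
  by apply: derivable_within_continuous => s /dl [].
have [s sh] := MVT h0 dlo cl.
by rewrite scale0r addr0 subr0 => E; exists s.
Qed.

(** Two mean value theorems: first along [v], for the difference [phi] of [g] on two parallel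
    segments, then along [w], for ['D_v g]. *)
Lemma second_difference {R : realType} {V : normedModType R} (g : V -> R)
    (D : set V) (p v w : V) (h : R) : 0 < h -> C2_on g D ->
  (forall a b : R, a \in `[0, h] -> b \in `[0, h] ->
     D (p + a *: v + b *: w)) ->
  exists a b : R, [/\ a \in `[0, h], b \in `[0, h] &
    g (p + h *: v + h *: w) - g (p + h *: v) - g (p + h *: w) + g p =
    'D_w ('D_v g) (p + a *: v + b *: w) * h * h].
Proof.
move=> h0 [C1 C2] Dp.
have h00 : (0 : R) \in `[0, h] by rewrite in_itv/= lexx ltW.
have hh : h \in `[0, h] by rewrite in_itv/= lexx ltW.
pose phi s := g (p + h *: w + s *: v) - g (p + s *: v).
have dphi s : s \in `[0, h] -> is_derive s 1 phi
    ('D_v g (p + h *: w + s *: v) - 'D_v g (p + s *: v)).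
  move=> sh; apply: is_deriveB; apply/is_derive_line/diff_derivable.
    by have [] := C1 _ (Dp _ _ sh hh); rewrite addrAC.
  by have [] := C1 _ (Dp _ _ sh h00); rewrite scale0r addr0.
have cphi : {within `[0, h], continuous phi}.
  by apply: derivable_within_continuous => s /dphi [].
have [a ah] := MVT h0 (fun s sh => dphi s (subset_itv_oo_cc sh)) cphi.
rewrite subr0 => Ea.
have {}ah : a \in `[0, h] by apply: subset_itv_oo_cc ah.
have dg s : s \in `[0, h] -> derivable ('D_v g) (p + a *: v + s *: w) w.
  by move=> sh; apply: diff_derivable; have [] := C2 v _ (Dp _ _ ah sh).
have [b bh Eb] := MVT_line _ _ _ _ h0 dg.
have {}bh : b \in `[0, h] by apply: subset_itv_oo_cc bh.
exists a, b; split => //.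
rewrite -Eb [p + a *: v + _]addrAC -Ea /phi scale0r !addr0.
by rewrite [p + h *: w + _]addrAC; ring.
Qed.

(** The second difference is symmetric in [v] and [w], so the two mixed derivatives agree at two
    points arbitrarily near [p]; were they different at [p], continuity would keep them apart. *)
Lemma derive_comm {R : realType} {V : normedModType R} (g : V -> R)
    (D : set V) (p v w : V) : open D -> C2_on g D -> D p ->
  'D_w ('D_v g) p = 'D_v ('D_w g) p.
Proof.
move=> oD C2g Dp; apply/eqP; apply: contrapT => /negP neq.
set A := 'D_w ('D_v g); set B := 'D_v ('D_w g).
have cA : {for p, continuous A} by have [_ /(_ v p Dp)[_ /(_ w)]] := C2g.
have cB : {for p, continuous B} by have [_ /(_ w p Dp)[_ /(_ v)]] := C2g.
pose e := `|A p - B p| / 2.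
have e0 : 0 < e by rewrite divr_gt0// normr_gt0 subr_eq0.
have nD : \forall x \near p, D x by exact: open_nbhs_nbhs.
have nA : \forall x \near p, `|A p - A x| < e.
  by move/cvgrPdist_lt : cA; apply.
have nB : \forall x \near p, `|B p - B x| < e.
  by move/cvgrPdist_lt : cB; apply.
have : \forall x \near p, [/\ D x, `|A p - A x| < e & `|B p - B x| < e].
  by apply: filterS3 nD nA nB.
move=> /nbhs_ballP[r /= r0 H].
(* The summand 1 keeps [M] positive when both vectors vanish. With the [h] below, [h * M = r / 2],
   so the parallelogram of side [h] stays in the ball of radius [r]. *)
pose M := `|v| + `|w| + 1.
have M0 : 0 < M by rewrite ltr_wpDl// addr_ge0.
pose h := r / M / 2.
have h0 : 0 < h by rewrite !divr_gt0.
have near_p (v' w' : V) a b : `|v'| + `|w'| + 1 = M ->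
    a \in `[0, h] -> b \in `[0, h] -> ball p r (p + a *: v' + b *: w').
  move=> EM; rewrite !in_itv/= => /andP[a_ge0 ah] /andP[b_ge0 bh].
  rewrite -ball_normE/= -addrA opprD addrA subrr add0r normrN.
  apply: (le_lt_trans (ler_normD _ _)); rewrite !normrZ !ger0_norm//.
  apply: (@le_lt_trans _ _ (h * M)); last first.
    by rewrite /h mulrAC divfK ?gt_eqF// ltr_pdivrMr// ltr_pMr// ltr1n.
  rewrite -EM mulrDr mulrDr mulr1; apply: ler_wpDr; first exact: ltW.
  by apply: lerD; apply: ler_wpM2r.
have [|a [b [ah bh Eab]]] := second_difference g D p v w h h0 C2g.
  by move=> a b ah bh; have [] := H _ (near_p v w a b erefl ah bh).
have EM : `|w| + `|v| + 1 = M by rewrite /M [`|w| + _]addrC.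
have [|a' [b' [ah' bh' Eab']]] := second_difference g D p w v h h0 C2g.
  by move=> c d ch dh; have [] := H _ (near_p w v c d EM ch dh).
have hn : h != 0 by rewrite gt_eqF.
have EAB : A (p + a *: v + b *: w) = B (p + a' *: w + b' *: v).
  have cancel (x y : R) : x * h * h = y * h * h -> x = y.
    by move=> /(mulIf hn)/(mulIf hn).
  apply: cancel; apply: (etrans (esym Eab)); apply: etrans Eab'.
  by rewrite [p + h *: w + _]addrAC; ring.
have [_ HA _] := H _ (near_p v w a b erefl ah bh).
have [_ _] := H _ (near_p w v a' b' EM ah' bh'); rewrite -EAB => HB.
have dist2 (x y z : R) : `|x - z| < e -> `|y - z| < e -> `|x - y| < e + e.
  move=> xz yz; apply: le_lt_trans (ler_distD z _ _) _.
  by rewrite [`|z - y|]distrC ltrD.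
have := dist2 _ _ _ HA HB.
by rewrite /e -splitr ltxx.
Qed.

(** * Positive curvature and the side of the tangent *)

Lemma derive_pair {R : realType} {W : normedModType R} (g : R * R -> W)
    (p u : R * R) : differentiable g p ->
  'D_u g p = u.1 *: 'D_((1, 0) : R * R) g p + u.2 *: 'D_((0, 1) : R * R) g p.
Proof.
move=> dg; rewrite !deriveE// -!linearZ -linearD; congr ('d g p _).
case: u => u1 u2 /=; transitivity (u1 * 1 + u2 * 0, u1 * 0 + u2 * 1) => //.
by rewrite !mulr1 !mulr0 addr0 add0r.
Qed.

(** Symmetry turns ['D_ex ('D_u g)] into ['D_u ('D_ex g)], which expands linearly in [u] at [p];
    likewise for [ey]. It also merges the two mixed terms. *)
Lemma derive2_pair {R : realType} (g : R * R -> R) (D : set (R * R))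
    (p u : R * R) : open D -> C2_on g D -> D p ->
  'D_u ('D_u g) p =
    u.1 ^+ 2 * 'D_((1, 0) : R * R) ('D_((1, 0) : R * R) g) p
    + 2 * u.1 * u.2 * 'D_((0, 1) : R * R) ('D_((1, 0) : R * R) g) p
    + u.2 ^+ 2 * 'D_((0, 1) : R * R) ('D_((0, 1) : R * R) g) p.
Proof.
move=> oD C2g Dp; have dg v : differentiable ('D_v g) p.
  by have [_ /(_ v p Dp)[]] := C2g.
set ex : R * R := (1, 0); set ey : R * R := (0, 1).
have E := derive_pair ('D_u g) p u (dg u).
have Ex := derive_pair ('D_ex g) p u (dg ex).
have Ey := derive_pair ('D_ey g) p u (dg ey).
have alg (a b b' d d' xx xy yx yy u1 u2 : R) :
    a = u1 *: b + u2 *: d -> b = b' -> d = d' -> b' = u1 *: xx + u2 *: xy ->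
    d' = u1 *: yx + u2 *: yy -> yx = xy ->
    a = u1 ^+ 2 * xx + 2 * u1 * u2 * xy + u2 ^+ 2 * yy.
  by rewrite /GRing.scale/= => -> -> -> -> -> ->; ring.
exact: alg E (derive_comm g D p u ex oD C2g Dp)
  (derive_comm g D p u ey oD C2g Dp) Ex Ey (derive_comm g D p ey ex oD C2g Dp).
Qed.

(** The gradient is evaluated at [x] and the Hessian at [e], because the mean value theorem will
    produce two different points. The form is jointly continuous, and the factor [K p p] normalizes
    its sign. *)
Lemma quadratic_form_near_gt0 {R : realType} {V : normedModType R}
    (X Y A B C : V -> R) (p : V) :
  {for p, continuous X} -> {for p, continuous Y} -> {for p, continuous A} ->
  {for p, continuous B} -> {for p, continuous C} ->
  let K (x e : V) :=
    A e * Y x ^+ 2 - 2 * B e * X x * Y x + C e * X x ^+ 2 in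
  K p p != 0 ->
  exists2 r : R, 0 < r &
    forall x e, ball p r x -> ball p r e -> 0 < K p p * K x e.
Proof.
move=> cX cY cA cB cC K Kn0.
have c1 (G : V -> R) : {for p, continuous G} ->
    G z.1 @[z --> (p, p)] --> G p.
  move=> cG; apply: (@cvg_comp _ _ _ fst G _ (nbhs p)) => //; exact: cvg_fst.
have c2 (G : V -> R) : {for p, continuous G} ->
    G z.2 @[z --> (p, p)] --> G p.
  move=> cG; apply: (@cvg_comp _ _ _ snd G _ (nbhs p)) => //; exact: cvg_snd.
have cK : K p p * K z.1 z.2 @[z --> (p, p)] --> K p p * K p p.
  apply: cvgM; first exact: cvg_cst.
  rewrite /K; under eq_fun do rewrite !expr2.
  rewrite !expr2.
  by apply: cvgD; [apply: cvgB|]; repeat apply: cvgM;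
    (exact: cvg_cst || exact: c1 || exact: c2).
have K0 : 0 < K p p * K p p by rewrite -expr2 exprn_even_gt0.
have : \forall z \near (p, p), 0 < K p p * K z.1 z.2.
  by move/cvgr_gt : cK; apply.
move=> /nbhs_ballP[r /= r0 H]; exists r => // x e px pe.
exact: (H (x, e)).
Qed.

(** In the plane, a vector orthogonal to [(X, Y)] is a multiple of [(Y, - X)], here by [m / N]; on
    it the Hessian form is the curvature numerator times a positive square. *)
Lemma quadratic_form_orthogonal_gt0 {R : realFieldType}
    (k X Y A B C u1 u2 : R) :
  0 < k * (A * Y ^+ 2 - 2 * B * X * Y + C * X ^+ 2) ->
  u1 * X + u2 * Y = 0 -> (u1 != 0) || (u2 != 0) ->
  0 < k * (u1 ^+ 2 * A + 2 * u1 * u2 * B + u2 ^+ 2 * C).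
Proof.
move=> F0 uXY u0.
set N := X ^+ 2 + Y ^+ 2; set m := u1 * Y - u2 * X.
have E1 : u1 * N = m * Y.
  have -> : u1 * N = m * Y + X * (u1 * X + u2 * Y) by rewrite /m /N; ring.
  by rewrite uXY mulr0 addr0.
have E2 : u2 * N = - (m * X).
  have -> : u2 * N = - (m * X) + Y * (u1 * X + u2 * Y) by rewrite /m /N; ring.
  by rewrite uXY mulr0 addr0.
have N0 : 0 < N.
  rewrite lt_neqAle addr_ge0 ?sqr_ge0// andbT eq_sym.
  apply/negP; rewrite paddr_eq0 ?sqr_ge0// !sqrf_eq0 => /andP[/eqP X0 /eqP Y0].
  by move: F0; rewrite X0 Y0 expr0n/= !mulr0 subr0 addr0 mulr0 ltxx.
have m0 : m != 0.
  apply/eqP => m0; move: E1 E2; rewrite m0 !mul0r oppr0.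
  move=> /eqP; rewrite mulf_eq0 (gt_eqF N0) orbF => u10.
  move=> /eqP; rewrite mulf_eq0 (gt_eqF N0) orbF => u20.
  by move: u0; rewrite u10 u20.
have N2 : 0 < N ^+ 2 by rewrite exprn_gt0.
rewrite -(pmulr_rgt0 _ N2).
have -> : N ^+ 2 * (k * (u1 ^+ 2 * A + 2 * u1 * u2 * B + u2 ^+ 2 * C)) =
   k * ((u1 * N) ^+ 2 * A + 2 * (u1 * N) * (u2 * N) * B + (u2 * N) ^+ 2 * C).
  by ring.
rewrite E1 E2.
have -> : k * ((m * Y) ^+ 2 * A + 2 * (m * Y) * (- (m * X)) * B +
    (- (m * X)) ^+ 2 * C) =
  m ^+ 2 * (k * (A * Y ^+ 2 - 2 * B * X * Y + C * X ^+ 2)) by ring.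
by rewrite mulr_gt0// exprn_even_gt0.
Qed.

Lemma ball_segment {R : realType} {V : normedModType R} (p x y : V) (r s : R) :
  ball p r x -> ball p r y -> s \in `[0, 1] -> ball p r (x + s *: (y - x)).
Proof.
rewrite -!ball_normE/= in_itv/= => px py /andP[s0 s1].
have -> : p - (x + s *: (y - x)) = (1 - s) *: (p - x) + s *: (p - y).
  have -> : y - x = (p - x) - (p - y) by rewrite opprB [RHS]addrC addrA subrK.
  rewrite opprD addrA scalerBl scale1r [s *: (_ - (p - y))]scalerBr opprB.
  by rewrite addrA addrAC.
apply: (le_lt_trans (ler_normD _ _)); rewrite !normrZ ger0_norm ?subr_ge0//.
rewrite ger0_norm//.
case: (eqVneq s 0) => [->|sn0]; first by rewrite subr0 mul1r mul0r addr0.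
have sp : 0 < s by rewrite lt_def sn0.
have -> : r = (1 - s) * r + s * r by ring.
by apply: ler_ltD; [rewrite ler_wpM2l ?subr_ge0// ltW|rewrite ltr_pM2l].
Qed.

(* [(a x, b x)] is a multiple of the gradient of [g] at [x]: the level curve
   lies strictly on one side of its tangent at [x]. If [g x = g y], the mean
   value theorem gives a zero [xi] of [g'] along the segment, so [y - x] is
   orthogonal to the gradient at [xi]; the second derivative along [y - x] then
   has the sign of the numerator of the curvature. *)
Lemma level_curve_strict_side {R : realType} (g : R * R -> R)
    (D : set (R * R)) (p : R * R) : open D -> C2_on g D -> D p ->
  0 < curvature g p ->
  exists (a b : R * R -> R) (r : R), 0 < r /\
    forall x y, ball p r x -> ball p r y -> g x = g y -> x != y ->
      a x * (y.1 - x.1) + b x * (y.2 - x.2) < 0.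
Proof.
move=> oD C2g Dp curv.
have [C1g C2g'] := C2g.
set ex : R * R := (1, 0); set ey : R * R := (0, 1).
have c1 v : {for p, continuous ('D_v g)} by have [] := C1g p Dp.
have c2 v w : {for p, continuous ('D_w ('D_v g))}.
  by have [] := C2g' v p Dp.
have [k [r1 r10 Hr1]] : exists k : R, exists2 r : R, 0 < r &
    forall x e, ball p r x -> ball p r e ->
    0 < k * ('D_ex ('D_ex g) e * 'D_ey g x ^+ 2
      - 2 * 'D_ey ('D_ex g) e * 'D_ex g x * 'D_ey g x
      + 'D_ey ('D_ey g) e * 'D_ex g x ^+ 2).
  (* Unification takes for [k] the signed numerator of the curvature at [p], which is nonzero since
     the curvature is positive. *)
  eexists; apply: quadratic_form_near_gt0 (c1 _) (c1 _) (c2 _ _) (c2 _ _)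
    (c2 _ _) _.
  apply/eqP => K0; move: curv; rewrite /curvature.
  have alg (a b : R) : a = 0 -> 0 < `|a| / b -> False.
    by move=> ->; rewrite normr0 mul0r ltxx.
  exact: alg K0.
have [r2 /= r20 Dr2] : nbhs_ball p D by apply/nbhs_ballP; exact: open_nbhs_nbhs.
exists (fun x => k * 'D_ex g x), (fun x => k * 'D_ey g x), (Num.min r1 r2).
have sub1 : ball p (Num.min r1 r2) `<=` ball p r1.
  by apply: le_ball; rewrite ge_min lexx.
have sub2 : ball p (Num.min r1 r2) `<=` D.
  by move=> x xr; apply/Dr2/le_ball/xr; rewrite ge_min lexx orbT.
split; first by rewrite lt_min r10.
move=> x y px py gxy xy.
set u := y - x.
have seg s : s \in `[0, 1] -> ball p (Num.min r1 r2) (x + s *: u).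
  exact: ball_segment.
have dg s : s \in `[0, 1] -> derivable g (x + s *: u) u.
  by move=> /seg/sub2 Ds; apply: diff_derivable; have [] := C1g _ Ds.
have [s s01 Es] := MVT_line g x u 1 ltr01 dg.
have s01' : s \in `[0, 1] by apply: subset_itv_oo_cc s01.
have s0 : 0 < s by move: s01; rewrite in_itv/= => /andP[].
have Ps := seg _ s01'.
have dg' t : t \in `[0, s] -> derivable ('D_u g) (x + t *: u) u.
  rewrite in_itv/= => /andP[t0 ts].
  have /seg/sub2 Ds : t \in `[0, 1].
    rewrite in_itv/= t0 (le_trans ts)//.
    by move: s01'; rewrite in_itv/= => /andP[].
  by apply: diff_derivable; have [] := C2g' u _ Ds.
have [t ts Et] := MVT_line ('D_u g) x u s s0 dg'.
have Pt : ball p (Num.min r1 r2) (x + t *: u).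
  apply: seg; move: ts s01'; rewrite !in_itv/= => /andP[t0 ts] /andP[_ s1].
  by rewrite ltW//= (le_trans (ltW ts)).
have dgs : differentiable g (x + s *: u) by have [] := C1g _ (sub2 _ Ps).
have Ks := Hr1 _ _ (sub1 _ Ps) (sub1 _ Pt).
have E1 := derive_pair g _ u dgs.
have dgx : differentiable g x by have [] := C1g _ (sub2 _ px).
have E0 := derive_pair g _ u dgx.
have E2 := derive2_pair g D _ u oD C2g (sub2 _ Pt).
have u0 : (u.1 != 0) || (u.2 != 0).
  rewrite -negb_and; apply/negP => /andP[/eqP u1 /eqP u2].
  move: xy; rewrite eq_sym -subr_eq0 -/u => /eqP; apply.
  by rewrite [u]surjective_pairing u1 u2.
have gu : g (x + 1 *: u) - g x = 0.
  by rewrite scale1r /u [x + _]addrC subrK gxy subrr.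
(* The derivative along [u] is [Gs = 0] at the intermediate point, hence [Gx = - Q * s] at [x], and
   [k * Q] is positive by orthogonality. *)
have fin (Gs Gx Q X Y X0 Y0 A B C : R) :
    Gx = u.1 *: X0 + u.2 *: Y0 ->
    g (x + 1 *: u) - g x = Gs * 1 -> Gs - Gx = Q * s ->
    Gs = u.1 *: X + u.2 *: Y ->
    Q = u.1 ^+ 2 * A + 2 * u.1 * u.2 * B + u.2 ^+ 2 * C ->
    0 < k * (A * Y ^+ 2 - 2 * B * X * Y + C * X ^+ 2) ->
    k * X0 * u.1 + k * Y0 * u.2 < 0.
  rewrite gu mulr1 => EGx <-; rewrite sub0r => EQ /esym uXY QE F0.
  have := quadratic_form_orthogonal_gt0 _ _ _ _ _ _ _ _ F0 uXY u0.
  rewrite -QE => kQ; have -> : k * X0 * u.1 + k * Y0 * u.2 = - (k * Q * s).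
    transitivity (k * Gx); first by rewrite EGx /GRing.scale/=; ring.
    by rewrite -[Gx]opprK EQ; ring.
  by rewrite oppr_lt0 mulr_gt0.
exact: fin E0 Es Et E1 E2 Ks.
Qed.

(** * Components of solutions, short times and constants *)

Lemma caputo_solution_regular {R : realType} {n : nat} {alpha : R}
    {f : 'rV[R]_n -> 'rV[R]_n} {E : set 'rV[R]_n} {X : R -> 'rV[R]_n}
    {T : \bar R} (k : 'I_n) :
  caputo_solution alpha f E X T ->
  caputo_regular alpha (fun s => X s ord0 k) T.
Proof.
move=> [cX _ dX]; split; last first.
  by move=> t t0 tT; have [d1 d2 d3 _] := dX t k t0 tT.
move=> s; apply: (@cvg_comp _ _ _ X (fun Z : 'rV[R]_n => Z ord0 k)).
  exact: cX.
exact: coord_continuous.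
Qed.

Lemma caputo_solution_near0 {R : realType} {n : nat} {alpha : R}
    {f : 'rV[R]_n -> 'rV[R]_n} {E : set 'rV[R]_n} {X : R -> 'rV[R]_n}
    {T : \bar R} {A : set 'rV[R]_n} :
  (0 < T)%E -> caputo_solution alpha f E X T -> nbhs (X 0) A ->
  exists d : R, [/\ 0 < d, (d%:E < T)%E & forall t, t \in `[0, d] -> A (X t)].
Proof.
move=> T0 [cX _ _] XA.
have [d1 d10 d1T] : exists2 d : R, 0 < d & (d%:E < T)%E.
  case: T T0 {cX} => [b|_|//]; last by exists 1 => //; rewrite ltry.
  rewrite lte_fin => b0; exists (b / 2); first exact: divr_gt0.
  by rewrite lte_fin ltr_pdivrMr// ltr_pMr// ltr1n.
have := (subspace_continuousP _ _).1 cX 0 (conj (lexx 0) T0) A XA.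
move=> /nbhs_ballP[e /= e0 He].
(* Halving [e] puts the closed time interval inside the open ball; [d1] keeps it below [T]. *)
exists (Num.min d1 (e / 2)); split.
- by rewrite lt_min d10 divr_gt0.
- by apply: le_lt_trans d1T; rewrite lee_fin ge_min lexx.
move=> t; rewrite in_itv/= le_min => /andP[t0 /andP[td te]].
apply: He; last by split => //; apply: le_lt_trans d1T; rewrite lee_fin.
rewrite -ball_normE/= sub0r normrN ger0_norm//.
by apply: (le_lt_trans te); rewrite ltr_pdivrMr// ltr_pMr// ltr1n.
Qed.

(** A constant has both a maximum and a minimum at [t], with zero increase: the extremum principle
    for [x] and [- x] gives the two inequalities. *)
Lemma caputo_constant {R : realType} {alpha t : R} {T : \bar R}
    {x : R -> R} :
  0 < alpha -> alpha < 1 -> caputo_regular alpha x T ->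
  0 < t -> (t%:E < T)%E ->
  (forall s : R, s \in `[0, t] -> x s = x t) -> caputo alpha x t = 0.
Proof.
move=> a0 a1 rx t0 tT xt.
have x0 : x 0 = x t by apply: xt; rewrite in_itv/= lexx ltW.
apply/eqP; rewrite eq_le; apply/andP; split.
  have := caputo_ge_at_max a0 a1 (caputo_regular_lincomb rx rx (-1) 0) t0 tT.
  rewrite (caputo_lincomb rx rx)//= x0 subrr !mulr0 !mul0r !addr0 !mulN1r.
  by rewrite oppr_ge0; apply => s st; rewrite xt// mulN1r mul0r addr0.
have := caputo_ge_at_max a0 a1 rx t0 tT; rewrite x0 subrr !mulr0.
by apply => s st; rewrite xt.
Qed.

(** * Invariance against positive curvature *)

Theorem theorem4p3 (R : realType) (n : nat) (alpha : R)
    (E : set 'rV[R]_n) (f : 'rV[R]_n -> 'rV[R]_n)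
    (Phi : R -> 'rV[R]_n -> 'rV[R]_n) (T : 'rV[R]_n -> \bar R)
    (i j : 'I_n) (P : 'rV[R]_n) (D : set (R * R)) (g : R * R -> R) (c : R)
    (alpha_gt0 : 0 < alpha) (alpha_lt1 : alpha < 1)
    (E_open : open E) (f_C1 : C1_on f E)
    (equilibrium_0 : equilibrium f E 0)
    (Phi_solution : solution_map alpha f E Phi T)
    (i_neq_j : i != j) (D_open : open D) (g_C2 : C2_on g D)
    (not_straight : exists X : 'rV[R]_n,
       [/\ level_curve E i j P D g c X,
           0 < curvature g (coord_pair i j X) &
           ~ equilibrium f E X]) :
  ~ invariant_under Phi T (level_curve E i j P D g c).
Proof.
move=> inv; have [X0 [LX0 curv neq0]] := not_straight.
set L := level_curve _ _ _ _ _ _ _ in inv LX0.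
pose p := coord_pair (R := R) i j.
have [EX0 DX0 _ _] := LX0.
have [a [b [r [r0 side]]]] :=
  level_curve_strict_side g D (p X0) D_open g_C2 DX0 curv.
have coord_cts (k : 'I_n) (Y : 'rV[R]_n) :
    {for Y, continuous (fun Z : 'rV[R]_n => Z ord0 k)}.
  exact: coord_continuous.
have f_cts (k : 'I_n) (Y : 'rV[R]_n) : E Y ->
    {for Y, continuous (fun Z => f Z ord0 k)}.
  move=> EY; apply: (@continuous_comp _ _ _ f (fun Z : 'rV[R]_n => Z ord0 k)).
    by apply: differentiable_continuous; have [] := f_C1 _ EY.
  exact: coord_continuous.
have p_cts Y : {for Y, continuous p}.
  exact: (cvg_pair (coord_cts i Y) (coord_cts j Y)).
have ball_nbhs Y : ball (p X0) r (p Y) -> nbhs Y (p @^-1` ball (p X0) r).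
  move=> pY; apply: p_cts; apply: open_nbhs_nbhs; split=> //.
  exact: ball_open.
(* The equality case is recorded because the final contradiction rests on a strict inequality
   between [Y] and [X0]. *)
have side_le Y Z : L Y -> L Z -> ball (p X0) r (p Y) -> ball (p X0) r (p Z) ->
    a (p Y) * Z ord0 i + b (p Y) * Z ord0 j <=
    a (p Y) * Y ord0 i + b (p Y) * Y ord0 j ?= iff (p Y == p Z).
  move=> [_ _ gY _] [_ _ gZ _] bY bZ.
  have [pYZ|neq] := eqVneq (p Y) (p Z).
    by apply/leifP; case: (pYZ) => -> ->.
  apply/leifP; have := side _ _ bY bZ (etrans gY (esym gZ)) neq.
  by rewrite /= !mulrBr addrACA -opprD subr_lt0.
(* The solution restarted at [Y] need not continue an earlier one through [Y], because of the
   memory, but it too is confined to the curve. The normal stays frozen at [Y], and continuity of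
   [f] keeps the sign for a short time. *)
have tangent_le0 Y : L Y -> ball (p X0) r (p Y) ->
    a (p Y) * f Y ord0 i + b (p Y) * f Y ord0 j <= 0.
  move=> LY bY; rewrite leNgt; apply/negP => fpos.
  have [EY _ _ _] := LY; have [TY0 PhiY sol] := Phi_solution Y EY.
  have nA : nbhs (Phi 0 Y) [set Z | ball (p X0) r (p Z) /\
      0 < a (p Y) * f Z ord0 i + b (p Y) * f Z ord0 j].
    rewrite PhiY; apply: filterI; first exact: ball_nbhs.
    have c1 : a (p Y) * f Z ord0 i + b (p Y) * f Z ord0 j @[Z --> Y] -->
       a (p Y) * f Y ord0 i + b (p Y) * f Y ord0 j.
      exact: (cvgD (cvgM (cvg_cst _) (f_cts i Y EY))
                   (cvgM (cvg_cst _) (f_cts j Y EY))).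
    by move/cvgr_gt : c1; apply.
  have [d [d0 dT near_Y]] := caputo_solution_near0 TY0 sol nA.
  have rx := caputo_solution_regular i sol.
  have ry := caputo_solution_regular j sol.
  have [] := caputo_gt0_increase alpha_gt0 alpha_lt1
    (caputo_regular_lincomb rx ry (a (p Y)) (b (p Y))) d0 dT.
    move=> s; rewrite in_itv/= => /andP[s0 sd].
    have sT : (s%:E < T Y)%E by apply: le_lt_trans dT; rewrite lee_fin.
    rewrite (caputo_lincomb rx ry)//; have [_ _ eqn] := sol.
    have [_ _ _ ->] := eqn s i s0 sT; have [_ _ _ ->] := eqn s j s0 sT.
    by have [] := near_Y s; rewrite // in_itv/= ltW.
  move=> s; rewrite in_itv/= => /andP[s0 sd].
  have sT : (s%:E < T Y)%E by apply: le_lt_trans dT; rewrite lee_fin.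
  apply/negP; rewrite -leNgt PhiY.
  have [||//] := side_le Y (Phi s Y) LY _ bY.
    exact: inv (ltW s0) sT.
  by have [] := near_Y s; rewrite // in_itv/= ltW.
have [T0 Phi0 sol] := Phi_solution X0 EX0.
(* The component [k] may differ from [i] and [j]. That it stays nonzero for a short time serves
   twice: for the Gamma factor, and to exclude a constant solution. *)
have [k fk] : exists k, f X0 ord0 k != 0.
  apply: contrapT => fk; apply: neq0; split => //; apply/rowP => k.
  by rewrite mxE; apply: contrapT => fkn; apply: fk; exists k; apply/eqP.
have nA : nbhs (Phi 0 X0) [set Z | ball (p X0) r (p Z) /\ f Z ord0 k != 0].
  rewrite Phi0; apply: filterI; first by apply: ball_nbhs; exact: ballxx.
  have := f_cts k X0 EX0; move=> /cvgr_neq0; exact.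
have [d [d0 dT near0]] := caputo_solution_near0 T0 sol nA.
have [_ _ eqn] := sol.
have dd : d \in `[0, d] by rewrite in_itv/= lexx ltW.
have LX t : t \in `[0, d] -> L (Phi t X0).
  rewrite in_itv/= => /andP[t0 td]; apply: inv => //.
  by apply: le_lt_trans dT; rewrite lee_fin.
(* With [1 / Gamma = 0], [f] would vanish along the solution; this spares the
   proof that the Gamma integral converges to a nonzero value. *)
have Gamma_neq0 : (Gamma (1 - alpha))^-1 != 0.
  apply/eqP => G0; have [_] := near0 d dd; apply/negP; rewrite negbK.
  by have [_ _ _ <-] := eqn d k d0 dT; rewrite /caputo G0 mul0r.
(* If the planar coordinates never moved, neither would the others, which the curve fixes; the
   solution would be constant, with zero Caputo derivative, against the choice of [k]. *)
have [t td pt] : exists2 t, t \in `]0, d] & p (Phi t X0) != p X0.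
  apply: contrapT => Pconst.
  have {}Pconst t : t \in `[0, d] -> p (Phi t X0) = p X0.
    rewrite in_itv/= le_eqVlt => /andP[/predU1P[<- _|t0 td]].
      by rewrite Phi0.
    apply: contrapT => /eqP ne; apply: Pconst; exists t => //.
    by rewrite in_itv/= t0.
  have Xconst t : t \in `[0, d] -> Phi t X0 = X0.
    move=> td; have [pi pj] := Pconst t td.
    have [_ _ _ P1] := LX t td; have [_ _ _ P2] := LX0.
    apply/rowP => l; have [->//|li] := eqVneq l i.
    have [->//|lj] := eqVneq l j.
    by rewrite P1// P2.
  have := caputo_constant alpha_gt0 alpha_lt1 (caputo_solution_regular k sol)
    d0 dT.
  have [_ _ _ ->] := eqn d k d0 dT => H.
  have [_] := near0 d dd; rewrite H ?eqxx// => s sd.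
  by rewrite !Xconst.
have {}td' : t \in `[0, d] by apply: subset_itv_oc_cc td.
move: td; rewrite in_itv/= => /andP[t0 td].
have tT : (t%:E < T X0)%E by apply: le_lt_trans dT; rewrite lee_fin.
set Y := Phi t X0 in pt.
have LY : L Y by exact: LX.
have bY : ball (p X0) r (p Y) by have [] := near0 t td'.
have rx := caputo_solution_regular i sol.
have ry := caputo_solution_regular j sol.
have /= := caputo_ge_at_max alpha_gt0 alpha_lt1
  (caputo_regular_lincomb rx ry (a (p Y)) (b (p Y))) t0 tT.
rewrite (caputo_lincomb rx ry)//.
have [_ _ _ ->] := eqn t i t0 tT; have [_ _ _ ->] := eqn t j t0 tT.
rewrite -/Y Phi0 => H.
have tmax : forall s : R, s \in `[0, t] ->
    a (p Y) * Phi s X0 ord0 i + b (p Y) * Phi s X0 ord0 j <=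
    a (p Y) * Y ord0 i + b (p Y) * Y ord0 j.
  move=> s; rewrite in_itv/= => /andP[s0 st].
  have sd : s \in `[0, d] by rewrite in_itv/= s0 (le_trans st).
  have [bs _] := near0 s sd.
  by have [] := side_le Y (Phi s X0) LY (LX s sd) bY bs.
(* The lower bound from the maximum at [t] is positive: so are the Gamma factor and the power of
   [t], and [pt] excludes equality in [side_le]. *)
have := le_trans (H tmax) (tangent_le0 Y LY bY); apply/negP; rewrite -ltNge.
apply: mulr_gt0; first by rewrite lt_def Gamma_neq0 invr_ge0 Gamma_ge0.
apply: mulr_gt0; first exact: powR_gt0.
have bX0 : ball (p X0) r (p X0) by exact: ballxx.
by rewrite subr_gt0 (lt_leif (side_le Y X0 LY LX0 bY bX0)).
Qed.
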